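(* Let $R$ be a ring and $(P,Q,\psi)$ an $R$-system. Then there exists an injective and surjective covariant representation $(\iota_P,\iota_Q,\iota_R,\mathcal{T}_{(P,Q,\psi)})$ of $(P,Q,\psi)$ with the following property: (TP) If $(S,T,\sigma,B)$ is a covariant representation of $(P,Q,\psi)$, then there exists a unique ring homomorphism $\eta_{(S,T,\sigma,B)}:\mathcal{T}_{(P,Q,\psi)}\to B$ such that $\eta_{(S,T,\sigma,B)}\circ\iota_R=\sigma$, $\eta_{(S,T,\sigma,B)}\circ\iota_Q=T$ and $\eta_{(S,T,\sigma,B)}\circ\iota_P=S$. Moreover, $(\iota_P,\iota_Q,\iota_R,\mathcal{T}_{(P,Q,\psi)})$ is, up to isomorphism in $\mathcal{C}_{(P,Q,\psi)}$, the unique surjective covariant representation of $(P,Q,\psi)$ which possesses property (TP); in fact, if $(S,T,\sigma,B)$ is a surjective covariant representation of $(P,Q,\psi)$ and $\phi:B\to\mathcal{T}_{(P,Q,\psi)}$ is a ring homomorphism such that $\phi\circ\sigma=\iota_R$, $\phi\circ S=\iota_P$ and $\phi\circ T=\iota_Q$, then $\phi$ is an isomorphism. For $m,n\in\mathbb{N}$ let $\mathcal{T}_{(m,n)}:=\operatorname{span}\{\iota_Q^m(q)\iota_P^n(p)\mid q\in Q^{\otimes m},\ p\in P^{\otimes n}\}$, for $k\in\mathbb{N}$ let $\mathcal{T}_{(k,0)}:=\iota_Q^k(Q^{\otimes k})$ and $\mathcal{T}_{(0,k)}:=\iota_P^k(P^{\otimes k})$, and let $\mathcal{T}_{(0,0)}:=\iota_R(R)$.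 Then $\bigoplus_{(m,n)\in\mathscr{S}}\mathcal{T}_{(m,n)}$ is an $\mathscr{S}$-grading of $\mathcal{T}_{(P,Q,\psi)}$, and it is the only $\mathscr{S}$-grading $\bigoplus_{(m,n)\in\mathscr{S}}\mathcal{Y}_{(m,n)}$ of $\mathcal{T}_{(P,Q,\psi)}$ such that $\iota_R(R)\subseteq\mathcal{Y}_{(0,0)}$, $\iota_Q(Q)\subseteq\mathcal{Y}_{(1,0)}$ and $\iota_P(P)\subseteq\mathcal{Y}_{(0,1)}$.
   Context: Rings are associative, not necessarily unital. For $R$-bimodules $P,Q$, $P\otimes Q$ is the $R$-balanced tensor product. ''Linear'' means additive and ''span'' means additive span. $\mathbb{N}=\{1,2,\dots\}$, $\mathbb{N}_0=\mathbb{N}\cup\{0\}$. An $R$-system is a triple $(P,Q,\psi)$ where $P,Q$ are $R$-bimodules and $\psi:P\otimes Q\to R$ is an $R$-bimodule homomorphism. A covariant representation of $(P,Q,\psi)$ is a quadruple $(S,T,\sigma,B)$ where $B$ is a ring, $S:P\to B$ and $T:Q\to B$ are linear maps, $\sigma:R\to B$ is a ring homomorphism, and $S(pr)=S(p)\sigma(r)$, $S(rp)=\sigma(r)S(p)$, $T(qr)=T(q)\sigma(r)$, $T(rq)=\sigma(r)T(q)$, $\sigma(\psi(p\otimes q))=S(p)T(q)$ for all $r\in R,p\in P,q\in Q$. It is surjective if $B$ is generated as a ring by $\sigma(R)\cup T(Q)\cup S(P)$, and injective if $\sigma$ is injective. $\mathcal{C}_{(P,Q,\psi)}$ is the category whose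 objects are the surjective covariant representations of $(P,Q,\psi)$ and whose morphisms $(S_1,T_1,\sigma_1,B_1)\to(S_2,T_2,\sigma_2,B_2)$ are the ring homomorphisms $\phi:B_1\to B_2$ with $\phi\circ T_1=T_2$, $\phi\circ S_1=S_2$, $\phi\circ\sigma_1=\sigma_2$. $P^{\otimes n},Q^{\otimes n}$ ($n\ge1$) are the $n$-fold tensor powers over $R$. For a covariant representation $(S,T,\sigma,B)$ and $n\in\mathbb{N}$, $T^n:Q^{\otimes n}\to B$ and $S^n:P^{\otimes n}\to B$ are the linear maps with $T^n(q_1\otimes\cdots\otimes q_n)=T(q_1)\cdots T(q_n)$ and $S^n(p_1\otimes\cdots\otimes p_n)=S(p_1)\cdots S(p_n)$; in particular this defines $\iota_Q^n$ and $\iota_P^n$. $\mathscr{S}$ is the semigroup $\mathbb{N}_0^2$ with multiplication $(m,n)(k,l)=(m,n-k+l)$ if $n\ge k$, and $(m,n)(k,l)=(m+k-n,l)$ if $k\ge n$. An $\mathscr{S}$-grading of a ring $A$ is a decomposition $A=\bigoplus_{s\in\mathscr{S}}A_s$ of the additive group with $A_sA_t\subseteq A_{st}$. *)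

(* Defs.v *)
From HB Require Import structures.
From mathcomp Require Import all_boot all_order all_algebra.
From mathcomp Require Import generic_quotient ring_quotient.
From mathcomp Require Import boolp classical_sets functions cardinality fsbigop.
From mathcomp Require Import zify.
From mathcomp.multinomials Require Import freeg.

Set Implicit Arguments.
Unset Strict Implicit.
Unset Printing Implicit Defensive.

Import GRing.Theory.

Local Open Scope quotient_scope.
Local Open Scope classical_set_scope.
Local Open Scope ring_scope.
Local Open Scope group_scope.

(* Associative rings, not necessarily unital nor commutative. [x * y] is the
   semigroup product (group_scope); [0], [x + y], [- x] are in ring_scope. *)
HB.mixin Record isNuRing R of GRing.Zmodule R & Semigroup R := {
  numulDl : forall x y z : R, (x + y) * z = (x * z)%g + (y * z)%g;
  numulDr : forall x y z : R, x * (y + z) = (x * y)%g + (x * z)%g;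
}.

#[short(type="nuRingType")]
HB.structure Definition NuRing :=
  {R of isNuRing R & GRing.Zmodule R & Semigroup R}.

Definition nuring_hom (A B : nuRingType) (f : A -> B) : Prop :=
  zmod_morphism f /\ {morph f : x y / x * y >-> x * y}.

Definition nuring_iso (A B : nuRingType) (f : A -> B) : Prop :=
  nuring_hom f /\
  exists g : B -> A, [/\ nuring_hom g, cancel f g & cancel g f].

Definition subgroup_set (A : zmodType) (X : set A) : Prop :=
  X 0 /\ forall x y, X x -> X y -> X (x - y).

Definition additive_span (A : zmodType) (X : set A) : set A :=
  smallest (@subgroup_set A) X.

Definition subring_set (A : nuRingType) (X : set A) : Prop :=
  subgroup_set X /\ forall x y, X x -> X y -> X (x * y).

Definition generated_subring (A : nuRingType) (X : set A) : set A :=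
  smallest (@subring_set A) X.

(* No unit axiom, since R need not have a unit. *)
HB.mixin Record isBimodule (R : nuRingType) M of GRing.Zmodule M := {
  lact : R -> M -> M;
  ract : M -> R -> M;
  lactDl : forall r s x, lact (r + s) x = lact r x + lact s x;
  lactDr : forall r x y, lact r (x + y) = lact r x + lact r y;
  lactA : forall r s x, lact (r * s) x = lact r (lact s x);
  ractDl : forall x y r, ract (x + y) r = ract x r + ract y r;
  ractDr : forall x r s, ract x (r + s) = ract x r + ract x s;
  ractA : forall x r s, ract x (r * s) = ract (ract x r) s;
  lractA : forall r x s, ract (lact r x) s = lact r (ract x s);
}.

#[short(type="bimodType")]
HB.structure Definition Bimodule (R : nuRingType) :=
  {M of isBimodule R M & GRing.Zmodule M}.

Definition regular_bimod (R : nuRingType) : Type := R.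

Section RegularBimodule.
Variable R : nuRingType.
HB.instance Definition _ := GRing.Zmodule.copy (regular_bimod R) R.
HB.instance Definition _ := isBimodule.Build R (regular_bimod R)
  (@numulDl R) (@numulDr R) (fun r s x => esym (mulgA r s x))
  (@numulDl R) (@numulDr R) (fun x r s => mulgA x r s)
  (fun r x s => esym (mulgA r x s)).
End RegularBimodule.

Definition bimod_hom (R : nuRingType) (M N : bimodType R) (f : M -> N) : Prop :=
  [/\ zmod_morphism f, forall r x, f (lact r x) = lact r (f x)
    & forall x r, f (ract x r) = ract (f x) r].

(* The R-balanced tensor product: the free abelian group on P * Q modulo the
   subgroup generated by the relations of biadditivity and balancedness. *)
Section Tensor.
Variables (R : nuRingType) (P Q : bimodType R).
Implicit Types (p : P) (q : Q) (r : R).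

Inductive tensor_relator : {freeg (P * Q)%type} -> Prop :=
| TensorDl p p' q :
    tensor_relator (<< (p + p', q) >> - << (p, q) >> - << (p', q) >>)
| TensorDr p q q' :
    tensor_relator (<< (p, q + q') >> - << (p, q) >> - << (p, q') >>)
| TensorA p r q :
    tensor_relator (<< (ract p r, q) >> - << (p, lact r q) >>).

Definition tensor_relations : pred {freeg (P * Q)%type} :=
  fun z => `[< additive_span tensor_relator z >].

Lemma tensor_relations_zmod_closed : zmod_closed tensor_relations.
Proof.
split; first by apply/asboolP => X [[X0 _] _].
move=> x y /asboolP hx /asboolP hy; apply/asboolP => X XP.
by case: (XP) => [[_ XB] _]; apply: XB; [apply: hx|apply: hy].
Qed.

HB.instance Definition _ :=
  GRing.isZmodClosed.Build {freeg (P * Q)%type} tensor_relations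
    tensor_relations_zmod_closed.

Definition tensor_quot :=
  Quotient.quot (GRing.ZmodClosed.clone _ tensor_relations _).
Definition tensor : Type := tensor_quot.

HB.instance Definition _ := GRing.Zmodule.on tensor.

Definition tens p q : tensor := \pi_tensor_quot << (p, q) >>.

(* The map p (x) q |-> f p q; only meaningful when f is balanced. *)
Definition tensor_lift (M : zmodType) (f : P -> Q -> M) (t : tensor) : M :=
  fglift (fun pq : P * Q => f pq.1 pq.2 : zmodule M)
    (repr (t : tensor_quot)).

Definition balanced (M : zmodType) (f : P -> Q -> M) : Prop :=
  [/\ forall p p' q, f (p + p') q = f p q + f p' q,
      forall p q q', f p (q + q') = f p q + f p q'
    & forall p r q, f (ract p r) q = f p (lact r q)].

End Tensor.

Lemma zmod_morphD (U V : zmodType) (f : U -> V) :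
  zmod_morphism f -> {morph f : x y / x + y}.
Proof.
move=> fB x y; have fN z : f (- z) = - f z.
  have f0 : f 0 = 0 by have := fB 0 0; rewrite !subrr.
  by rewrite -[- z]sub0r fB f0 sub0r.
by rewrite -[y in LHS]opprK fB fN opprK.
Qed.

Section TensorTheory.
Variables (R : nuRingType) (P Q : bimodType R).
Implicit Types (p : P) (q : Q) (r : R) (t : tensor P Q).

Lemma tensDl p p' q : tens (p + p') q = tens p q + tens p' q.
Proof.
rewrite /tens -raddfD; apply/eqP; rewrite -Quotient.idealrBE.
by apply/asboolP => X [_]; apply; rewrite opprD addrA; exact: TensorDl.
Qed.

Lemma tensDr p q q' : tens p (q + q') = tens p q + tens p q'.
Proof.
rewrite /tens -raddfD; apply/eqP; rewrite -Quotient.idealrBE.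
by apply/asboolP => X [_]; apply; rewrite opprD addrA; exact: TensorDr.
Qed.

Lemma tensA p r q : tens (ract p r) q = tens p (lact r q).
Proof.
apply/eqP; rewrite -Quotient.idealrBE.
by apply/asboolP => X [_]; apply; exact: TensorA.
Qed.

Lemma tensor_ind (X : set (tensor P Q)) :
  subgroup_set X -> (forall p q, X (tens p q)) -> forall t, X t.
Proof.
move=> [X0 XB] Xtens t.
have XN x : X x -> X (- x) by move=> /(XB _ _ X0); rewrite sub0r.
have XD x y : X x -> X y -> X (x + y).
  by move=> hx /XN hy; rewrite -[y]opprK; apply: XB.
have XMz x (n : int) : X x -> X (x *~ n).
  move=> hx; have XMn k : X (x *+ k).
    by elim: k => [|k IHk]; rewrite ?mulr0n // mulrS; apply: XD.
  by case: n => k; [exact: XMn | rewrite NegzE mulrNz; apply: XN; exact: XMn].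
rewrite -[t](@reprK _ (tensor_quot P Q)).
rewrite -[repr _]freeg_sumE raddf_sum /=.
elim/big_rec: _ => // -[p q] x _ Xx; apply: XD => //.
by rewrite -[coeff _ _]intz -freegU_mulz raddfMz; apply: XMz; exact: Xtens.
Qed.

Lemma tensor_hom_eq (M : zmodType) (f g : tensor P Q -> M) :
  zmod_morphism f -> zmod_morphism g ->
  (forall p q, f (tens p q) = g (tens p q)) -> f =1 g.
Proof.
move=> fB gB fg; apply: (@tensor_ind [set t | f t = g t]) => //=.
have h0 (h : tensor P Q -> M) : zmod_morphism h -> h 0 = 0.
  by move=> hB; have := hB 0 0; rewrite !subrr.
split; first by rewrite /= !h0.
by move=> x y /= fgx fgy; rewrite fB gB fgx fgy.
Qed.

Section Lift.
Variables (M : zmodType) (f : P -> Q -> M) (fbal : balanced f).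

Let F := fglift (fun pq : P * Q => f pq.1 pq.2 : zmodule M).

Let FB : zmod_morphism F.
Proof. exact: lift_is_additive. Qed.

Let F1 p q : F << (p, q) >> = f p q.
Proof. by rewrite /F liftU scale1r. Qed.

Let F_rel z : tensor_relations z -> F z = 0.
Proof.
move=> /asboolP zX; apply: (zX [set z | F z = 0]); split.
  split=> [|x y /= Fx Fy]; last by rewrite FB Fx Fy subrr.
  by have := FB 0 0; rewrite !subrr.
case: fbal => fDl fDr fA.
move=> y yrel; suff: F y = 0 by []; case: yrel => *; rewrite !FB !F1 -?addrA -?opprD.
- by rewrite fDl subrr.
- by rewrite fDr subrr.
- by rewrite fA subrr.
Qed.

Let lift_pi z :
  tensor_lift f (\pi_(tensor_quot P Q) z) = F z.
Proof.
apply/eqP; rewrite -subr_eq0 -FB; apply/eqP/F_rel.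
set y := _ - z.
rewrite -[tensor_relations y]/(y \in GRing.ZmodClosed.clone _ (@tensor_relations R P Q) _).
by rewrite Quotient.idealrBE reprK.
Qed.

Lemma tensor_liftB : zmod_morphism (tensor_lift f : tensor P Q -> M).
Proof.
move=> t u.
rewrite -[t](@reprK _ (tensor_quot P Q)).
rewrite -[u](@reprK _ (tensor_quot P Q)).
by rewrite -raddfB !lift_pi FB.
Qed.

Lemma tensor_liftE p q : tensor_lift f (tens p q) = f p q.
Proof. by rewrite lift_pi F1. Qed.

End Lift.
End TensorTheory.

Section TensorBimodule.
Variables (R : nuRingType) (P Q : bimodType R).

Definition tensor_lact (r : R) : tensor P Q -> tensor P Q :=
  tensor_lift (fun p q => tens (lact r p) q).

Definition tensor_ract (t : tensor P Q) (r : R) : tensor P Q :=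
  tensor_lift (fun p q => tens p (ract q r)) t.

Let balanced_l r : balanced (fun (p : P) (q : Q) => tens (lact r p) q).
Proof.
split=> [p p' q|p q q'|p s q]; first by rewrite lactDr tensDl.
- by rewrite tensDr.
- by rewrite -lractA tensA.
Qed.

Let balanced_r r : balanced (fun (p : P) (q : Q) => tens p (ract q r)).
Proof.
split=> [p p' q|p q q'|p s q]; first by rewrite tensDl.
- by rewrite ractDl tensDr.
- by rewrite tensA lractA.
Qed.

Let lactB r : zmod_morphism (tensor_lact r) := tensor_liftB (balanced_l r).
Let ractB r : zmod_morphism (tensor_ract^~ r) := tensor_liftB (balanced_r r).

Lemma lact_tens r (p : P) (q : Q) : tensor_lact r (tens p q) = tens (lact r p) q.
Proof. exact: (tensor_liftE (balanced_l r)). Qed.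

Lemma ract_tens (p : P) (q : Q) r : tensor_ract (tens p q) r = tens p (ract q r).
Proof. exact: (tensor_liftE (balanced_r r)). Qed.

Let zmod_morphism_add (f g : tensor P Q -> tensor P Q) :
  zmod_morphism f -> zmod_morphism g -> zmod_morphism (fun t => f t + g t).
Proof. by move=> fB gB x y; rewrite fB gB opprD addrACA. Qed.

Let tensor_lactDl r s t :
  tensor_lact (r + s) t = tensor_lact r t + tensor_lact s t.
Proof.
apply: (@tensor_hom_eq _ _ _ _ (tensor_lact (r + s))
  (fun t => tensor_lact r t + tensor_lact s t)) => //.
- exact: zmod_morphism_add.
- by move=> p q; rewrite !lact_tens lactDl tensDl.
Qed.

Let tensor_lactA r s t : tensor_lact (r * s) t = tensor_lact r (tensor_lact s t).
Proof.
apply: (@tensor_hom_eq _ _ _ _ (tensor_lact (r * s))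
  (fun t => tensor_lact r (tensor_lact s t))) => //.
- by move=> x y; rewrite !lactB.
- by move=> p q; rewrite !lact_tens lactA.
Qed.

Let tensor_ractDr t r s :
  tensor_ract t (r + s) = tensor_ract t r + tensor_ract t s.
Proof.
apply: (@tensor_hom_eq _ _ _ _ (tensor_ract^~ (r + s))
  (fun t => tensor_ract t r + tensor_ract t s)) => //.
- exact: (@zmod_morphism_add (tensor_ract^~ r) (tensor_ract^~ s)).
- by move=> p q; rewrite !ract_tens ractDr tensDr.
Qed.

Let tensor_ractA t r s : tensor_ract t (r * s) = tensor_ract (tensor_ract t r) s.
Proof.
apply: (@tensor_hom_eq _ _ _ _ (tensor_ract^~ (r * s))
  (fun t => tensor_ract (tensor_ract t r) s)) => //.
- by move=> x y; rewrite !ractB.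
- by move=> p q; rewrite !ract_tens ractA.
Qed.

Let tensor_lractA r t s :
  tensor_ract (tensor_lact r t) s = tensor_lact r (tensor_ract t s).
Proof.
apply: (@tensor_hom_eq _ _ _ _ (fun t => tensor_ract (tensor_lact r t) s)
  (fun t => tensor_lact r (tensor_ract t s))) => //.
- by move=> x y; rewrite lactB ractB.
- by move=> x y; rewrite ractB lactB.
- by move=> p q; rewrite !(lact_tens, ract_tens).
Qed.

HB.instance Definition _ := isBimodule.Build R (tensor P Q)
  tensor_lactDl (fun r => zmod_morphD (lactB r)) tensor_lactA
  (fun x y r => zmod_morphD (ractB r) x y) tensor_ractDr tensor_ractA tensor_lractA.

End TensorBimodule.

(* [tensor_pow Q n] is the (n+1)-fold tensor power of Q, bracketed to the left,
   since the 0-fold power is not used. *)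
Fixpoint tensor_pow (R : nuRingType) (Q : bimodType R) (n : nat) : bimodType R :=
  if n is n'.+1 then tensor (tensor_pow Q n') Q else Q.

(* [pow_map f n] maps q_0 (x) ... (x) q_n to f q_0 * ... * f q_n. *)
Fixpoint pow_map (R : nuRingType) (Q : bimodType R) (B : nuRingType)
    (f : Q -> B) (n : nat) : tensor_pow Q n -> B :=
  match n return tensor_pow Q n -> B with
  | 0 => f
  | n'.+1 => tensor_lift (fun (x : tensor_pow Q n') (q : Q) =>
                            pow_map f x * f q)
  end.

Section PowMapTheory.
Variables (R : nuRingType) (Q : bimodType R) (B : nuRingType).
Variables (f : Q -> B) (sigma : R -> B).
Hypothesis fB : zmod_morphism f.
Hypothesis fR : forall q r, f (ract q r) = f q * sigma r.
Hypothesis fL : forall r q, f (lact r q) = sigma r * f q.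

Let balanced_pow n : zmod_morphism (pow_map f (n := n)) ->
  (forall x r, pow_map f (n := n) (ract x r) = pow_map f x * sigma r) ->
  balanced (fun (x : tensor_pow Q n) (q : Q) => pow_map f x * f q).
Proof.
move=> gB gR; split=> [x x' q|x q q'|x r q].
- by rewrite (zmod_morphD gB) numulDl.
- by rewrite (zmod_morphD fB) numulDr.
- by rewrite gR fL mulgA.
Qed.

Let pow_map_spec n : zmod_morphism (pow_map f (n := n)) /\
  (forall x r, pow_map f (n := n) (ract x r) = pow_map f x * sigma r).
Proof.
elim: n => [|n [gB gR]]; first by [].
have bal := balanced_pow gB gR; have liftB := tensor_liftB bal.
split=> [|x r]; first exact: liftB.
have ractB : zmod_morphism (fun t : tensor_pow Q n.+1 => ract t r).
  by move=> u v; apply/eqP; rewrite eq_sym subr_eq -ractDl subrK.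
have mulB (c : B) : zmod_morphism (fun b : B => b * c).
  by move=> u v; apply/eqP; rewrite eq_sym subr_eq -numulDl subrK.
apply: (@tensor_hom_eq _ _ _ _
  (fun t => tensor_lift (fun y q => pow_map f y * f q) (ract t r))
  (fun t => tensor_lift (fun y q => pow_map f y * f q) t * sigma r)).
- by move=> y z; rewrite -liftB; congr tensor_lift; exact: ractB.
- by move=> y z; rewrite liftB mulB.
- move=> y q; rewrite [ract _ _]ract_tens.
  by rewrite !(tensor_liftE bal) fR mulgA.
Qed.

Lemma pow_mapB n : zmod_morphism (pow_map f (n := n)).
Proof. by case: (pow_map_spec n). Qed.

Lemma pow_map_tens n (x : tensor_pow Q n) (q : Q) :
  pow_map f (n := n.+1) (tens x q) = pow_map f x * f q.
Proof.
case: (pow_map_spec n) => gB gR.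
exact: (tensor_liftE (balanced_pow gB gR)).
Qed.

End PowMapTheory.

Section CovariantRepresentations.
Variables (R : nuRingType) (P Q : bimodType R) (psi : tensor P Q -> R).

Record covrep := CovRep {
  cr_ring :> nuRingType;
  cr_S : P -> cr_ring;
  cr_T : Q -> cr_ring;
  cr_sigma : R -> cr_ring;
  cr_S_additive : zmod_morphism cr_S;
  cr_T_additive : zmod_morphism cr_T;
  cr_sigma_hom : nuring_hom cr_sigma;
  cr_SR : forall p r, cr_S (ract p r) = cr_S p * cr_sigma r;
  cr_SL : forall r p, cr_S (lact r p) = cr_sigma r * cr_S p;
  cr_TR : forall q r, cr_T (ract q r) = cr_T q * cr_sigma r;
  cr_TL : forall r q, cr_T (lact r q) = cr_sigma r * cr_T q;
  cr_psi : forall p q, cr_sigma (psi (tens p q)) = cr_S p * cr_T q;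
}.

Definition cr_surjective (X : covrep) : Prop :=
  generated_subring (range (cr_sigma X) `|` range (cr_T X) `|` range (cr_S X))
    = [set: X].

Definition cr_injective (X : covrep) : Prop := injective (cr_sigma X).

Definition cr_hom (X Y : covrep) (phi : X -> Y) : Prop :=
  [/\ nuring_hom phi, phi \o cr_sigma X = cr_sigma Y,
      phi \o cr_T X = cr_T Y & phi \o cr_S X = cr_S Y].

Definition cr_isomorphic (X Y : covrep) : Prop :=
  exists (phi : X -> Y) (phi' : Y -> X),
    [/\ cr_hom phi, cr_hom phi', cancel phi phi' & cancel phi' phi].

Definition property_TP (X : covrep) : Prop :=
  forall Y : covrep, exists! eta : X -> Y, cr_hom eta.

End CovariantRepresentations.

Definition bicyclic : Type := (nat * nat)%type.

Definition bicyclic_mul (s t : bicyclic) : bicyclic :=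
  let: (m, n) := s in let: (k, l) := t in
  if (k <= n)%N then (m, n - k + l)%N else (m + k - n, l)%N.

Lemma bicyclic_mulA : associative bicyclic_mul.
Proof.
move=> [m n] [k l] [i j]; rewrite /bicyclic_mul.
case: (leqP k n) => ?; case: (leqP i l) => ?;
  repeat (case: ifP => /= ?); congr pair; lia.
Qed.

HB.instance Definition _ := Choice.copy bicyclic (nat * nat)%type.
HB.instance Definition _ := isSemigroup.Build bicyclic bicyclic_mulA.

Definition direct_sum_decomposition (G : choiceType) (A : zmodType)
    (F : G -> set A) : Prop :=
  (forall s, subgroup_set (F s)) /\
  forall a : A, exists! f : G -> A,
    [/\ forall s, F s (f s), finite_set [set s | f s != 0]
      & a = \sum_(s \in [set: G]) f s].

Definition is_grading (G : semigroupType) (A : nuRingType) (F : G -> set A)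
    : Prop :=
  direct_sum_decomposition F /\
  forall s t x y, F s x -> F t y -> F (s * t) (x * y).

(* The exponents of [pow_map] are shifted by one, as those of [tensor_pow]. *)
Definition toeplitz_component (R : nuRingType) (P Q : bimodType R)
    (psi : tensor P Q -> R) (X : covrep psi) (s : bicyclic) : set X :=
  match s with
  | (0, 0) => range (cr_sigma X)
  | (k.+1, 0) => range (pow_map (cr_T X) (n := k))
  | (0, k.+1) => range (pow_map (cr_S X) (n := k))
  | (m.+1, n.+1) => additive_span
      [set x | exists (q : tensor_pow Q m) (p : tensor_pow P n),
                 x = pow_map (cr_T X) q * pow_map (cr_S X) p]
  end.

Arguments toeplitz_component {R P Q psi} X s _.

(* Main.v *)
(* The Toeplitz ring consists of the ring terms in R, Q and P modulo equality in
   every covariant representation; its universal property is then immediate.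

   iota_R is injective because some representation is faithful on R: the Fock
   representation on the product over n of the Q^n (x) R^1, where R^1 is the
   unitization, Q acts by creation, P by contraction along psi.

   The grading comes from a coaction. As (0,1)(1,0) = (0,0) in the bicyclic
   semigroup S, placing sigma, T and S in the degrees (0,0), (1,0) and (0,1) gives
   a covariant representation in the semigroup ring over S, hence a homomorphism
   from the Toeplitz ring which sends x in T_s to x delta_s. Its coefficients
   project onto the T_s, which makes their sum direct; the sum is everything since
   it is stable under right multiplication by the generators. *)
Require Import Defs.
From HB Require Import structures.
From mathcomp Require Import all_boot all_order all_algebra.
From mathcomp Require Import finmap generic_quotient.
From mathcomp Require Import boolp classical_sets functions cardinality fsbigop.

Set Implicit Arguments.
Unset Strict Implicit.
Unset Printing Implicit Defensive.

Import GRing.Theory.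

Local Open Scope classical_set_scope.

(** * Additive maps, additive spans and generated subrings *)

Section AdditiveMaps.
Local Open Scope ring_scope.
Variables (U V : zmodType) (f : U -> V) (fB : zmod_morphism f).

(** Bundling an additive map makes the library lemmas on additive functions apply to it. *)
Definition additive_of : {additive U -> V} :=
  HB.pack f (GRing.isZmodMorphism.Build U V f fB).

Lemma zmod_morph0 : f 0 = 0.
Proof. exact: (raddf0 additive_of). Qed.

Lemma zmod_morphMz n : {morph f : x / x *~ n}.
Proof. exact: (raddfMz additive_of). Qed.

Lemma zmod_morph_sum (I : Type) (r : seq I) (E : I -> U) :
  f (\sum_(i <- r) E i) = \sum_(i <- r) f (E i).
Proof. exact: (raddf_sum additive_of). Qed.

End AdditiveMaps.

Section AdditiveClosure.
Local Open Scope ring_scope.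
Variable A : zmodType.

Lemma morphD_zmod (U V : zmodType) (f : U -> V) :
  {morph f : x y / x + y} -> zmod_morphism f.
Proof. by move=> fD x y; apply/eqP; rewrite eq_sym subr_eq -fD subrK. Qed.

Lemma sub_additive_span (X : set A) : X `<=` additive_span X.
Proof. exact: sub_smallest. Qed.

Lemma subgroup_additive_span (X : set A) : subgroup_set (additive_span X).
Proof.
split=> [Y [[Y0 _] _] //|x y hx hy Y YX].
by case: (YX) => [[_ YB] _]; apply: YB; [apply: hx|apply: hy].
Qed.

Lemma additive_span_min (X Y : set A) :
  subgroup_set Y -> X `<=` Y -> additive_span X `<=` Y.
Proof. by move=> Ygrp XY; apply: smallest_sub. Qed.

Lemma subgroup_range (B : zmodType) (f : B -> A) :
  zmod_morphism f -> subgroup_set (range f).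
Proof.
move=> fB; split=> [|_ _ [x _ <-] [y _ <-]]; last by exists (x - y).
by exists 0; rewrite ?(zmod_morph0 fB).
Qed.

Lemma subgroup_preimage (B : zmodType) (f : A -> B) (Y : set B) :
  zmod_morphism f -> subgroup_set Y -> subgroup_set (f @^-1` Y).
Proof.
move=> fB [Y0 YB]; split=> [|x y]; first by rewrite /preimage/= (zmod_morph0 fB).
by rewrite /preimage/= fB; exact: YB.
Qed.

End AdditiveClosure.

Section TensorAdditivity.
Local Open Scope ring_scope.
Variables (R : nuRingType) (P Q : bimodType R).

Lemma tensBl (q : Q) : zmod_morphism (fun p : P => tens p q).
Proof. by apply: morphD_zmod => p p'; rewrite tensDl. Qed.

Lemma tensBr (p : P) : zmod_morphism (fun q : Q => tens p q).
Proof. by apply: morphD_zmod => q q'; rewrite tensDr. Qed.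

End TensorAdditivity.

Section NonUnitalRings.
Local Open Scope ring_scope.
Local Open Scope group_scope.
Variable A : nuRingType.
Implicit Types a b : A.

Lemma numulBl b : zmod_morphism (fun a => a * b).
Proof. by apply: morphD_zmod => x y; rewrite numulDl. Qed.

Lemma numulBr a : zmod_morphism (fun b => a * b).
Proof. by apply: morphD_zmod => x y; rewrite numulDr. Qed.

Lemma generated_subring_min (X Y : set A) :
  subring_set Y -> X `<=` Y -> generated_subring X `<=` Y.
Proof. by move=> Yring XY; apply: smallest_sub. Qed.

End NonUnitalRings.

Section BimoduleTheory.
Local Open Scope ring_scope.
Variables (R : nuRingType) (M : bimodType R).

Lemma lactB (r : R) : zmod_morphism (lact r : M -> M).
Proof. by apply: morphD_zmod => x y; rewrite lactDr. Qed.

Lemma lactBl (x : M) : zmod_morphism (fun r : R => lact r x).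
Proof. by apply: morphD_zmod => r s; rewrite lactDl. Qed.

End BimoduleTheory.

(** * The endomorphism ring of an abelian group, and the unitization of a ring *)

Section Endomorphisms.
Local Open Scope ring_scope.
Variable M : zmodType.

(** The boolean form makes [endo] a subtype of [M -> M], from which it inherits its group
    structure. *)
Definition endo_pred : pred (M -> M) := fun f => `[< zmod_morphism f >].

Lemma endo_pred_zmod_closed : zmod_closed endo_pred.
Proof.
split=> [|f g /asboolP fB /asboolP gB]; apply/asboolP => x y /=.
  by rewrite /0 /= subrr.
have fgE z : (f - g) z = f z - g z by [].
by rewrite !fgE fB gB !opprB addrACA [RHS]addrACA [- g x + _]addrC.
Qed.

HB.instance Definition _ :=
  GRing.isZmodClosed.Build (M -> M) endo_pred endo_pred_zmod_closed.

Record endo := Endo { endo_fun :> M -> M; _ : endo_fun \in endo_pred }.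

HB.instance Definition _ := [isSub for endo_fun].
HB.instance Definition _ := [Choice of endo by <:].
HB.instance Definition _ := [SubChoice_isSubZmodule of endo by <:].

End Endomorphisms.

Section EndomorphismRing.
Local Open Scope ring_scope.
Local Open Scope group_scope.
Variable M : zmodType.
Implicit Types f g h : endo M.

Lemma endoB f : zmod_morphism f.
Proof. by case: f => f fB; apply/asboolP. Qed.

Lemma endoP f g : f =1 g -> f = g.
Proof. by move=> fg; apply: val_inj; apply: funext. Qed.

Definition endo_of (f : M -> M) (fB : zmod_morphism f) : endo M :=
  Endo (asboolT fB : f \in @endo_pred M).

Lemma endo_comp_subproof f g : zmod_morphism (f \o g).
Proof. by move=> x y; rewrite /= endoB endoB. Qed.

Definition endo_comp f g : endo M := endo_of (@endo_comp_subproof f g).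

Lemma endo_compA : associative endo_comp.
Proof. by move=> f g h; apply: endoP. Qed.

HB.instance Definition _ := isSemigroup.Build (endo M) endo_compA.

Lemma endo_mulE f g x : (f * g) x = f (g x).
Proof. by []. Qed.

Lemma endo_addE f g x : (f + g) x = f x + g x.
Proof. by []. Qed.

Lemma endo_mulDl f g h : (f + g) * h = (f * h)%g + (g * h)%g.
Proof. by apply: endoP. Qed.

Lemma endo_mulDr f g h : f * (g + h) = (f * g)%g + (f * h)%g.
Proof. by apply: endoP => x; rewrite endo_mulE !endo_addE (zmod_morphD (endoB f)). Qed.

HB.instance Definition _ := isNuRing.Build (endo M) endo_mulDl endo_mulDr.

End EndomorphismRing.

(* [unitization A] is Z x A with its left A-module structure; the right action
   is zero, as only the faithfulness of the left action matters. *)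
Definition unitization (A : nuRingType) : Type := (int * A)%type.

Section Unitization.
Local Open Scope ring_scope.
Local Open Scope group_scope.
Variable A : nuRingType.

HB.instance Definition _ := GRing.Zmodule.copy (unitization A) (int * A)%type.

Implicit Types (a b : A) (x y : unitization A).

Definition unitization_lact a x : unitization A := (0, a *~ x.1 + (a * x.2)%g).

Let actDl a b x :
  unitization_lact (a + b) x = unitization_lact a x + unitization_lact b x.
Proof. by congr pair; rewrite /= ?addr0 // mulrzDl numulDl addrACA. Qed.

Let actDr a x y :
  unitization_lact a (x + y) = unitization_lact a x + unitization_lact a y.
Proof. by congr pair; rewrite /= ?addr0 // mulrzDr numulDr addrACA. Qed.

Let actA a b x :
  unitization_lact (a * b) x = unitization_lact a (unitization_lact b x).
Proof.
congr pair; rewrite /= mulr0z add0r numulDr mulgA.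
by rewrite (zmod_morphMz (numulBr a)).
Qed.

HB.instance Definition _ := isBimodule.Build A (unitization A)
  actDl actDr actA (fun x y a => esym (addr0 (0 : unitization A)))
  (fun x a b => esym (addr0 (0 : unitization A))) (fun x a b => erefl)
  (fun a x b => esym (zmod_morph0 (morphD_zmod (actDr a)))).

Definition unitization1 : unitization A := (1%Z : int, 0).

(** This is the faithfulness of the left action: a is read off from its value at 1. *)
Lemma lact_unitization1 a : lact a unitization1 = (0, a) :> unitization A.
Proof. by congr pair; rewrite /= mulr1z (zmod_morph0 (numulBr a)) addr0. Qed.

End Unitization.

(** * The Fock representation *)

Section FockRepresentation.
Local Open Scope ring_scope.
Local Open Scope group_scope.
Variables (R : nuRingType) (P Q : bimodType R) (psi : tensor P Q -> R).
Hypothesis psi_hom : bimod_hom (psi : tensor P Q -> regular_bimod R).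
Implicit Types (p : P) (q : Q) (r : R).

Let psiB : zmod_morphism psi. Proof. by case: psi_hom. Qed.
Let psiL r t : psi (lact r t) = r * psi t. Proof. by case: psi_hom. Qed.
Let psiR t r : psi (ract t r) = psi t * r. Proof. by case: psi_hom. Qed.

Section Contraction.
Variable N : bimodType R.

Definition contract p : tensor Q N -> N :=
  tensor_lift (fun q (x : N) => lact (psi (tens p q)) x).

(** Balancedness is the right linearity of psi in the form psi(p, q r) = psi(p, q) r. *)
Lemma contract_balanced p :
  balanced (fun q (x : N) => lact (psi (tens p q)) x).
Proof.
split=> [q q' x|q x x'|q r x].
- by rewrite tensDr (zmod_morphD psiB) lactDl.
- by rewrite lactDr.
- by rewrite -lactA -psiR [ract (tens _ _) _]ract_tens.
Qed.

Lemma contractB p : zmod_morphism (contract p).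
Proof. exact: tensor_liftB (contract_balanced p). Qed.

Lemma contract_tens p q x : contract p (tens q x) = lact (psi (tens p q)) x.
Proof. exact: (tensor_liftE (contract_balanced p)). Qed.

Lemma contractBl t : zmod_morphism (contract^~ t).
Proof.
move=> p p'; apply: (@tensor_hom_eq _ _ _ _ _
  (fun t => contract p t - contract p' t)) => [|x y|q x].
- exact: contractB.
- by rewrite !contractB !opprB addrACA [RHS]addrACA [- _ + _]addrC.
- rewrite !contract_tens -lactBl -psiB; congr (lact (psi _) _).
  exact: tensBl.
Qed.

(** The scalar moves from q to p by the balancing of P and Q inside psi. *)
Lemma contract_lact p r t : contract p (lact r t) = contract (ract p r) t.
Proof.
apply: (@tensor_hom_eq _ _ _ _ (fun t => contract p (lact r t))) => [x y||q x].
- by rewrite lactB contractB.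
- exact: contractB.
- by rewrite [lact r _]lact_tens !contract_tens tensA.
Qed.

Lemma lact_contract r p t : contract (lact r p) t = lact r (contract p t).
Proof.
apply: (@tensor_hom_eq _ _ _ _ _ (fun t => lact r (contract p t))) => [|x y|q x].
- exact: contractB.
- by rewrite contractB lactB.
- by rewrite !contract_tens -lactA -psiL [lact r (tens _ _)]lact_tens.
Qed.

End Contraction.

(** The powers are bracketed to the right, so that creation adds the leftmost factor and contraction
    removes it. *)
Fixpoint fock_level (n : nat) : bimodType R :=
  if n is m.+1 then tensor Q (fock_level m) else unitization R.

(** With the product instead of the direct sum, elements are plain dependent functions without a
    support condition. *)
Definition fock : Type := forall n, fock_level n.

HB.instance Definition _ := gen_eqMixin fock.
HB.instance Definition _ := gen_choiceMixin fock.

Let fockP (x y : fock) : (forall n, x n = y n) -> x = y.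
Proof. exact: functional_extensionality_dep. Qed.

Let fock_add (x y : fock) : fock := fun n => x n + y n.
Let fock_opp (x : fock) : fock := fun n => - x n.

Let fock_addA : associative fock_add.
Proof. by move=> x y z; apply: fockP => n; apply: addrA. Qed.
Let fock_addC : commutative fock_add.
Proof. by move=> x y; apply: fockP => n; apply: addrC. Qed.
Let fock_add0 : left_id ((fun n => 0) : fock) fock_add.
Proof. by move=> x; apply: fockP => n; apply: add0r. Qed.
Let fock_addN : left_inverse ((fun n => 0) : fock) fock_opp fock_add.
Proof. by move=> x; apply: fockP => n; apply: addNr. Qed.

HB.instance Definition _ :=
  GRing.isZmodule.Build fock fock_addA fock_addC fock_add0 fock_addN.

Let fock_diffE (x y : fock) n : (x - y) n = x n - y n. Proof. by []. Qed.

Definition scale_fun r (x : fock) : fock := fun n => lact r (x n).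

Definition create_fun q (x : fock) : fock := fun n =>
  match n return fock_level n with 0 => 0 | m.+1 => tens q (x m) end.

Definition annihilate_fun p (x : fock) : fock := fun n => contract p (x n.+1).

Lemma scale_funB r : zmod_morphism (scale_fun r).
Proof. by move=> x y; apply: fockP => n; apply: lactB. Qed.

Lemma create_funB q : zmod_morphism (create_fun q).
Proof.
move=> x y; apply: fockP => -[|n]; first by rewrite fock_diffE /= subrr.
exact: tensBr.
Qed.

Lemma annihilate_funB p : zmod_morphism (annihilate_fun p).
Proof. by move=> x y; apply: fockP => n; apply: contractB. Qed.

Definition scale r : endo fock := endo_of (scale_funB r).
Definition create q : endo fock := endo_of (create_funB q).
Definition annihilate p : endo fock := endo_of (annihilate_funB p).

Let endo_fockP (f g : endo fock) : (forall x n, f x n = g x n) -> f = g.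
Proof. by move=> fg; apply: endoP => x; apply: fockP. Qed.

Lemma scale_hom : nuring_hom scale.
Proof.
split=> r s; apply: endo_fockP => x n; last exact: lactA.
exact: (lactBl (x n)).
Qed.

Lemma createB : zmod_morphism create.
Proof.
move=> q q'; apply: endo_fockP => x [|n].
  by rewrite [RHS](subrr (0 : fock_level 0)).
exact: tensBl.
Qed.

Lemma annihilateB : zmod_morphism annihilate.
Proof. by move=> p p'; apply: endo_fockP => x n; apply: (contractBl (x n.+1)). Qed.

Lemma annihilateR p r : annihilate (ract p r) = annihilate p * scale r.
Proof. by apply: endo_fockP => x n; rewrite [RHS]contract_lact. Qed.

Lemma annihilateL r p : annihilate (lact r p) = scale r * annihilate p.
Proof. by apply: endo_fockP => x n; apply: lact_contract. Qed.

Lemma createR q r : create (ract q r) = create q * scale r.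
Proof. by apply: endo_fockP => x [|n] //; apply: tensA. Qed.

Lemma createL r q : create (lact r q) = scale r * create q.
Proof.
apply: endo_fockP => x [|n]; first by rewrite [RHS](zmod_morph0 (@lactB _ _ r)).
by rewrite [RHS]lact_tens.
Qed.

(** Creation followed by annihilation contracts the factor just added, at every level including the
    lowest. *)
Lemma scale_psi p q : scale (psi (tens p q)) = annihilate p * create q.
Proof. by apply: endo_fockP => x n; rewrite [RHS]contract_tens. Qed.

Definition fock_covrep : covrep psi :=
  CovRep annihilateB createB scale_hom annihilateR annihilateL createR createL
    scale_psi.

(** The vacuum vector, 1 at level 0, separates the elements of R, as r sends it to (0, r). *)
Lemma fock_covrep_injective : cr_injective fock_covrep.
Proof.
move=> r s rs; pose vac : fock := fun n =>
  if n is 0 return fock_level n then unitization1 R else 0.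
have := congr1 (fun f : endo fock => f vac 0%N) rs.
by rewrite /= /scale_fun !lact_unitization1 => -[].
Qed.

End FockRepresentation.

(** * Morphisms of covariant representations and the uniqueness of universal ones *)

Section Homomorphisms.
Local Open Scope ring_scope.
Local Open Scope group_scope.
Variables (R : nuRingType) (P Q : bimodType R) (psi : tensor P Q -> R).
Implicit Types X Y Z : covrep psi.

Lemma cr_homP X Y (phi : X -> Y) :
  nuring_hom phi -> (forall r, phi (cr_sigma X r) = cr_sigma Y r) ->
  (forall q, phi (cr_T X q) = cr_T Y q) ->
  (forall p, phi (cr_S X p) = cr_S Y p) -> cr_hom phi.
Proof. by move=> ? hR hT hS; split=> //; apply: funext. Qed.

Lemma cr_hom_sigma X Y (phi : X -> Y) r :
  cr_hom phi -> phi (cr_sigma X r) = cr_sigma Y r.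
Proof. by case=> _ /(congr1 (@^~ r)). Qed.

Lemma cr_hom_T X Y (phi : X -> Y) q : cr_hom phi -> phi (cr_T X q) = cr_T Y q.
Proof. by case=> _ _ /(congr1 (@^~ q)). Qed.

Lemma cr_hom_S X Y (phi : X -> Y) p : cr_hom phi -> phi (cr_S X p) = cr_S Y p.
Proof. by case=> _ _ _ /(congr1 (@^~ p)). Qed.

Lemma cr_hom_id X : cr_hom (@idfun X).
Proof. by []. Qed.

Lemma cr_hom_comp X Y Z (phi : X -> Y) (phi' : Y -> Z) :
  cr_hom phi -> cr_hom phi' -> cr_hom (phi' \o phi).
Proof.
move=> hphi hphi'; have [[phiB phiM] _ _ _] := hphi.
have [[phi'B phi'M] _ _ _] := hphi'.
apply: cr_homP => [|r|q|p] /=.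
- by split=> x y /=; [rewrite phiB phi'B|rewrite phiM phi'M].
- by rewrite (cr_hom_sigma r hphi) cr_hom_sigma.
- by rewrite (cr_hom_T q hphi) cr_hom_T.
- by rewrite (cr_hom_S p hphi) cr_hom_S.
Qed.

Lemma cr_surjective_ind X (W : set X) : cr_surjective X -> subring_set W ->
  (forall r, W (cr_sigma X r)) -> (forall q, W (cr_T X q)) ->
  (forall p, W (cr_S X p)) -> forall x, W x.
Proof.
move=> Xsurj Wring WR WT WS x.
have: [set: X] x by [].
rewrite -Xsurj; apply: generated_subring_min => //.
by move=> _ [[[r _ <-]|[q _ <-]]|[p _ <-]].
Qed.

(** The elements on which two morphisms agree form a subring that contains the generators. *)
Lemma cr_hom_eq X Y (phi phi' : X -> Y) :
  cr_surjective X -> cr_hom phi -> cr_hom phi' -> phi = phi'.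
Proof.
move=> Xsurj hphi hphi'; have [[phiB phiM] _ _ _] := hphi.
have [[phi'B phi'M] _ _ _] := hphi'.
apply: funext; apply: (@cr_surjective_ind X [set x | phi x = phi' x]) => //=.
- split; first split=> [|x y /= hx hy].
  + by rewrite /= !zmod_morph0.
  + by rewrite phiB phi'B hx hy.
  + by move=> x y /= hx hy; rewrite phiM phi'M hx hy.
- by move=> r; rewrite !cr_hom_sigma.
- by move=> q; rewrite !cr_hom_T.
- by move=> p; rewrite !cr_hom_S.
Qed.

(** The composite is an endomorphism of the surjective X, which [cr_hom_eq] identifies with the
    identity. *)
Lemma cr_hom_cancel X Y (phi : X -> Y) (phi' : Y -> X) : cr_surjective X ->
  cr_hom phi -> cr_hom phi' -> cancel phi phi'.
Proof.
move=> Xsurj hphi hphi' x.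
exact: (congr1 (@^~ x)
  (cr_hom_eq Xsurj (cr_hom_comp hphi hphi') (cr_hom_id X))).
Qed.

Lemma universal_cr_isomorphic X Y : cr_surjective X -> cr_surjective Y ->
  property_TP X -> property_TP Y -> cr_isomorphic Y X.
Proof.
move=> Xsurj Ysurj /(_ Y)[phi' [hphi' _]] /(_ X)[phi [hphi _]].
by exists phi, phi'; split=> //; apply: cr_hom_cancel.
Qed.

(** The inverse is the morphism from X to Y given by (TP); each cancellation law comes from the
    surjectivity of one of the two representations. *)
Lemma hom_to_universal_iso X Y (phi : Y -> X) : cr_surjective X ->
  cr_surjective Y -> property_TP X -> cr_hom phi -> nuring_iso phi.
Proof.
move=> Xsurj Ysurj /(_ Y)[phi' [hphi' _]] hphi.
split; first by case: hphi.
exists phi'; split; first by case: hphi'.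
- exact: cr_hom_cancel Ysurj hphi hphi'.
- exact: cr_hom_cancel Xsurj hphi' hphi.
Qed.

End Homomorphisms.

(** * The Toeplitz ring as a quotient of ring terms *)

Section ToeplitzRing.
Local Open Scope ring_scope.
Local Open Scope group_scope.
Local Open Scope quotient_scope.
Variables (R : nuRingType) (P Q : bimodType R) (psi : tensor P Q -> R).

Inductive term : Type :=
| TermR of R
| TermQ of Q
| TermP of P
| TermZero
| TermOpp of term
| TermAdd of term & term
| TermMul of term & term.

HB.instance Definition _ := gen_eqMixin term.
HB.instance Definition _ := gen_choiceMixin term.

Fixpoint eval (Y : covrep psi) (t : term) : Y :=
  match t with
  | TermR r => cr_sigma Y r
  | TermQ q => cr_T Y q
  | TermP p => cr_S Y p
  | TermZero => 0
  | TermOpp t => - eval Y t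
  | TermAdd t u => eval Y t + eval Y u
  | TermMul t u => eval Y t * eval Y u
  end.

(** The quantification over all representations stays inside a proposition, so the quotient is no
    larger than the type of terms. *)
Definition term_equiv : rel term :=
  fun t u => `[< forall Y : covrep psi, eval Y t = eval Y u >].

Lemma term_equiv_class : equiv_class_of term_equiv.
Proof.
split=> [t|t u|u t v /asboolP tu /asboolP uv].
- exact/asboolP.
- by apply/asboolP/asboolP => tu Y.
- by apply/asboolP => Y; rewrite tu.
Qed.

Canonical term_equiv_rel := EquivRelPack term_equiv_class.

Definition toeplitz : Type := {eq_quot term_equiv_rel}.

HB.instance Definition _ := Choice.on toeplitz.

Definition class_of (t : term) : toeplitz := \pi_{eq_quot term_equiv_rel} t.

Definition toeplitz_eval (Y : covrep psi) (x : toeplitz) : Y :=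
  eval Y (repr (x : {eq_quot term_equiv_rel})).

Lemma toeplitz_eval_class Y t : toeplitz_eval Y (class_of t) = eval Y t.
Proof.
have /eqmodP/asboolP := reprK (\pi_{eq_quot term_equiv_rel} t); exact.
Qed.

(** The evaluations are jointly injective by the choice of the equivalence. Every axiom and every
    covariance relation below is obtained by checking it in each representation. *)
Lemma toeplitz_ext (x y : toeplitz) :
  (forall Y, toeplitz_eval Y x = toeplitz_eval Y y) -> x = y.
Proof.
move=> xy; rewrite -[x](@reprK _ {eq_quot term_equiv_rel}).
by rewrite -[y](@reprK _ {eq_quot term_equiv_rel}); apply/eqmodP/asboolP.
Qed.

Let rp (x : toeplitz) : term := repr (x : {eq_quot term_equiv_rel}).

(** The operations act on chosen representatives; the evaluations commute with them, which is all
    that [toeplitz_ext] requires. *)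
Let add x y := class_of (TermAdd (rp x) (rp y)).
Let opp x := class_of (TermOpp (rp x)).
Let mul x y := class_of (TermMul (rp x) (rp y)).
Let zero := class_of TermZero.

Let evalD Y x y :
  toeplitz_eval Y (add x y) = toeplitz_eval Y x + toeplitz_eval Y y.
Proof. exact: toeplitz_eval_class. Qed.

Let evalN Y x : toeplitz_eval Y (opp x) = - toeplitz_eval Y x.
Proof. exact: toeplitz_eval_class. Qed.

Let evalM Y x y :
  toeplitz_eval Y (mul x y) = toeplitz_eval Y x * toeplitz_eval Y y.
Proof. exact: toeplitz_eval_class. Qed.

Let eval0 Y : toeplitz_eval Y zero = 0.
Proof. exact: toeplitz_eval_class. Qed.

Let addA : associative add.
Proof. by move=> x y z; apply: toeplitz_ext => Y; rewrite !evalD addrA. Qed.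
Let addC : commutative add.
Proof. by move=> x y; apply: toeplitz_ext => Y; rewrite !evalD addrC. Qed.
Let add0 : left_id zero add.
Proof. by move=> x; apply: toeplitz_ext => Y; rewrite evalD eval0 add0r. Qed.
Let addN : left_inverse zero opp add.
Proof. by move=> x; apply: toeplitz_ext => Y; rewrite evalD evalN eval0 addNr. Qed.
Let mulA : associative mul.
Proof. by move=> x y z; apply: toeplitz_ext => Y; rewrite !evalM mulgA. Qed.

HB.instance Definition _ := GRing.isZmodule.Build toeplitz addA addC add0 addN.
HB.instance Definition _ := isSemigroup.Build toeplitz mulA.

Let mulDl (x y z : toeplitz) : (x + y) * z = (x * z)%g + (y * z)%g.
Proof.
by apply: toeplitz_ext => Y; rewrite evalM !evalD !evalM numulDl.
Qed.

Let mulDr (x y z : toeplitz) : x * (y + z) = (x * y)%g + (x * z)%g.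
Proof.
by apply: toeplitz_ext => Y; rewrite evalM !evalD !evalM numulDr.
Qed.

HB.instance Definition _ := isNuRing.Build toeplitz mulDl mulDr.

Lemma toeplitz_eval_hom Y : nuring_hom (toeplitz_eval Y).
Proof.
by split=> x y; [rewrite -evalN -evalD|rewrite -evalM].
Qed.

Let evalB Y : zmod_morphism (toeplitz_eval Y) := (toeplitz_eval_hom Y).1.

Definition iotaR (r : R) : toeplitz := class_of (TermR r).
Definition iotaQ (q : Q) : toeplitz := class_of (TermQ q).
Definition iotaP (p : P) : toeplitz := class_of (TermP p).

Let evalR Y r : toeplitz_eval Y (iotaR r) = cr_sigma Y r.
Proof. exact: toeplitz_eval_class. Qed.
Let evalQ Y q : toeplitz_eval Y (iotaQ q) = cr_T Y q.
Proof. exact: toeplitz_eval_class. Qed.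
Let evalP Y p : toeplitz_eval Y (iotaP p) = cr_S Y p.
Proof. exact: toeplitz_eval_class. Qed.

Let iotaPB : zmod_morphism iotaP.
Proof.
move=> p p'; apply: toeplitz_ext => Y.
by rewrite evalB !evalP (cr_S_additive Y).
Qed.

Let iotaQB : zmod_morphism iotaQ.
Proof.
move=> q q'; apply: toeplitz_ext => Y.
by rewrite evalB !evalQ (cr_T_additive Y).
Qed.

Let iotaR_hom : nuring_hom iotaR.
Proof.
split=> r s; apply: toeplitz_ext => Y; have [sB sM] := cr_sigma_hom Y.
  by rewrite evalB !evalR sB.
by rewrite evalM !evalR sM.
Qed.

Let iotaPR p r : iotaP (ract p r) = iotaP p * iotaR r.
Proof. by apply: toeplitz_ext => Y; rewrite evalM evalR !evalP cr_SR. Qed.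
Let iotaPL r p : iotaP (lact r p) = iotaR r * iotaP p.
Proof. by apply: toeplitz_ext => Y; rewrite evalM evalR !evalP cr_SL. Qed.
Let iotaQR q r : iotaQ (ract q r) = iotaQ q * iotaR r.
Proof. by apply: toeplitz_ext => Y; rewrite evalM evalR !evalQ cr_TR. Qed.
Let iotaQL r q : iotaQ (lact r q) = iotaR r * iotaQ q.
Proof. by apply: toeplitz_ext => Y; rewrite evalM evalR !evalQ cr_TL. Qed.
Let iota_psi p q : iotaR (psi (tens p q)) = iotaP p * iotaQ q.
Proof. by apply: toeplitz_ext => Y; rewrite evalM evalR evalP evalQ cr_psi. Qed.

Definition toeplitz_covrep : covrep psi :=
  CovRep iotaPB iotaQB iotaR_hom iotaPR iotaPL iotaQR iotaQL iota_psi.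

Lemma toeplitz_surjective : cr_surjective toeplitz_covrep.
Proof.
apply/seteqP; split=> // x _ W [Wring WX].
have WR r : W (iotaR r) by apply: WX; left; left; exists r.
have WQ q : W (iotaQ q) by apply: WX; left; right; exists q.
have WP p : W (iotaP p) by apply: WX; right; exists p.
have [[W0 WB] WM] := Wring.
suff Wt : forall t, W (class_of t).
  by rewrite -[x](@reprK _ {eq_quot term_equiv_rel}); exact: Wt.
elim=> [r|q|p||t IHt|t IHt u IHu|t IHt u IHu] //.
- exact: WR.
- exact: WQ.
- exact: WP.
(* Subrings are closed under differences by definition, so opposites and sums are rewritten as
   differences. *)
- have -> : class_of (TermOpp t) = 0 - class_of t; last exact: WB.
  by apply: toeplitz_ext => Y; rewrite sub0r evalN !toeplitz_eval_class.
- have -> : class_of (TermAdd t u) = class_of t - (0 - class_of u).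
    apply: toeplitz_ext => Y.
    by rewrite sub0r opprK evalD !toeplitz_eval_class.
  exact: WB IHt (WB _ _ W0 IHu).
- have -> : class_of (TermMul t u) = class_of t * class_of u; last exact: WM.
  by apply: toeplitz_ext => Y; rewrite evalM !toeplitz_eval_class.
Qed.

Lemma toeplitz_eval_cr_hom (Y : covrep psi) :
  cr_hom (toeplitz_eval Y : toeplitz_covrep -> Y).
Proof.
apply: (@cr_homP _ _ _ _ toeplitz_covrep Y).
- exact: toeplitz_eval_hom.
- exact: evalR.
- exact: evalQ.
- exact: evalP.
Qed.

Lemma toeplitz_TP : property_TP toeplitz_covrep.
Proof.
move=> Y; exists (toeplitz_eval Y); split=> [|eta heta].
  exact: toeplitz_eval_cr_hom.
exact: cr_hom_eq toeplitz_surjective (toeplitz_eval_cr_hom Y) heta.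
Qed.

(** The map [cr_sigma Y] factors through [iotaR], so one representation faithful on R suffices. *)
Lemma toeplitz_injective (Y : covrep psi) :
  cr_injective Y -> cr_injective toeplitz_covrep.
Proof. by move=> Yinj r s /(congr1 (toeplitz_eval Y)); rewrite !evalR => /Yinj. Qed.

End ToeplitzRing.

(** * Direct sum decompositions obtained from projections, and their comparison *)

Section Decomposition.
Local Open Scope ring_scope.
Variables (G : choiceType) (A : zmodType) (F : G -> set A).

Lemma fsum_delta (t : G) (x : A) :
  \sum_(s \in [set: G]) (if s == t then x else 0) = x.
Proof.
rewrite (fsbigTE [fset t]%fset) => [|s]; last by rewrite inE; case: eqP.
by rewrite big_seq_fset1 eqxx.
Qed.

Lemma finite_support_delta (t : G) (x : A) :
  finite_set [set s | (if s == t then x else 0) != 0].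
Proof.
apply: (@sub_finite_set _ _ [set t]); last exact: finite_set1.
by move=> s /=; case: (s =P t) => [-> //|_]; rewrite eqxx.
Qed.

Section Projections.
Variable pr : G -> A -> A.
Hypothesis Fgrp : forall s, subgroup_set (F s).
Hypothesis prB : forall s, zmod_morphism (pr s).
Hypothesis prF : forall s t x, F t x -> pr s x = if s == t then x else 0.
Hypothesis Fspan : forall x, additive_span (\bigcup_(s in [set: G]) F s) x.

Let pr_spec x := [/\ forall s, F s (pr s x),
  finite_set [set s | pr s x != 0] & x = \sum_(s \in [set: G]) pr s x].

(** The three conditions define a subgroup that contains every [F t], hence everything by
    [Fspan]. *)
Let pr_specP x : pr_spec x.
Proof.
apply: (additive_span_min (Y := pr_spec)) (Fspan x) => [|y [t _ Fty]]; last first.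
  split.
  - move=> s; rewrite (prF _ Fty); case: eqP => [-> //|_].
    by case: (Fgrp s).
  - under eq_set do rewrite (prF _ Fty).
    exact: finite_support_delta.
  - under eq_fsbigr do rewrite (prF _ Fty).
    by rewrite fsum_delta.
split=> [|y z [Fy fy sy] [Fz fz sz]].
  have pr0 s : pr s 0 = 0 by rewrite zmod_morph0.
  split=> [s||].
  - by rewrite pr0; case: (Fgrp s).
  - apply: (@sub_finite_set _ _ set0) => // s /=.
    by rewrite pr0 eqxx.
  - by rewrite fsbig1.
split=> [s||].
- by rewrite prB; apply: (Fgrp s).2.
- apply: (@sub_finite_set _ _ ([set s | pr s y != 0] `|` [set s | pr s z != 0])).
    move=> s /=; rewrite prB; apply: contra_neqP => /not_orP[].
    by move=> /negP/negPn/eqP -> /negP/negPn/eqP ->; rewrite subrr.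
  by rewrite finite_setU.
(* One finite set containing the supports for y, z and their difference lets the three sums run over
   the same indices. *)
- pose B := (fset_set [set s | pr s y != 0] `|` fset_set [set s | pr s z != 0])%fset.
  have By s : s \notin B -> pr s y = 0.
    rewrite !inE !in_fset_set // negb_or => /andP[+ _].
    by rewrite notin_setE => /negP/negPn/eqP.
  have Bz s : s \notin B -> pr s z = 0.
    rewrite !inE !in_fset_set // negb_or => /andP[_].
    by rewrite notin_setE => /negP/negPn/eqP.
  rewrite (fsbigTE B) => [|s sB]; last by rewrite prB By // Bz // subrr.
  rewrite [in LHS]sy [in LHS]sz !(fsbigTE B) // -sumrB.
  by apply: eq_bigr => s _; rewrite prB.
Qed.

(** The projections recover the coefficients of any decomposition, which gives uniqueness. *)
Lemma pr_sum (f : G -> A) t : (forall s, F s (f s)) ->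
  finite_set [set s | f s != 0] -> pr t (\sum_(s \in [set: G]) f s) = f t.
Proof.
move=> Ff ffin; have f0 s : s \notin fset_set [set s | f s != 0] -> f s = 0.
  by rewrite in_fset_set // notin_setE => /negP/negPn/eqP.
rewrite (fsbigTE _ _ f0) (zmod_morph_sum (prB t)).
under eq_bigr do rewrite (prF _ (Ff _)).
(* The right side is spread into a delta sum over the support of f, to compare termwise; if t is
   outside the support, then f t = 0 and both sums vanish. *)
rewrite -[RHS](fsum_delta t) (fsbigTE (fset_set [set s | f s != 0])).
  by apply: eq_bigr => s _; rewrite eq_sym; case: eqP => // ->.
by move=> s /f0; case: eqP => // ->.
Qed.

Lemma projections_decomposition : direct_sum_decomposition F.
Proof.
split=> // x; exists (pr^~ x); split; first exact: pr_specP.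
by move=> f [Ff ffin ->]; apply: funext => s; rewrite pr_sum.
Qed.

(** Membership becomes an equation; products of components are located in this way. *)
Lemma projections_mem s x : pr s x = x -> F s x.
Proof. by move=> <-; case: (pr_specP x). Qed.

End Projections.

(** The decomposition of an element of [F' s] along F is also one along F', so it is the one
    concentrated in degree s. *)
Lemma direct_sum_sub_eq (F' : G -> set A) : direct_sum_decomposition F ->
  direct_sum_decomposition F' -> (forall s, F s `<=` F' s) -> F = F'.
Proof.
move=> [_ Fdec] [F'grp F'dec] FF'.
apply: funext => s; apply/seteqP; split=> [|x F'x]; first exact: FF'.
have [f [[Ff ffin xE] _]] := Fdec x; have [g [_ gP]] := F'dec x.
have gf : g = f by apply: gP; split=> // t; apply: FF'.
have gx : g = fun t => if t == s then x else 0.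
  apply: gP; split=> [t||]; last by rewrite fsum_delta.
    by case: eqP => [->//|_]; case: (F'grp t).
  exact: finite_support_delta.
by have := Ff s; rewrite -gf gx eqxx.
Qed.

End Decomposition.

(** * Images of tensor powers, and the bicyclic semigroup *)

Section Powers.
Local Open Scope ring_scope.
Local Open Scope group_scope.
Variables (R : nuRingType) (Q : bimodType R) (B : nuRingType).
Variables (f : Q -> B) (sigma : R -> B).
Hypothesis fB : zmod_morphism f.
Hypothesis fR : forall q r, f (ract q r) = f q * sigma r.
Hypothesis fL : forall r q, f (lact r q) = sigma r * f q.

Lemma pow_map_sub n (W : set B) : subgroup_set W ->
  (forall (x : tensor_pow Q n) q, W (pow_map f x * f q)) ->
  range (pow_map f (n := n.+1)) `<=` W.
Proof.
move=> Wgrp WM _ [t _ <-].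
apply: (@tensor_ind _ _ _ (pow_map f (n := n.+1) @^-1` W)) t => [|x q].
  exact: subgroup_preimage (pow_mapB fB fR fL (n := n.+1)) Wgrp.
by have := WM x q; rewrite -(pow_map_tens fB fR fL).
Qed.

Lemma pow_map_mul n (x : tensor_pow Q n) q :
  range (pow_map f (n := n.+1)) (pow_map f x * f q).
Proof. by rewrite -(pow_map_tens fB fR fL); apply: imageT. Qed.

(** The last tensor factor absorbs the scalar. *)
Lemma pow_map_scale n (x : tensor_pow Q n) r :
  range (pow_map f (n := n)) (pow_map f x * sigma r).
Proof.
case: n x => [|n] x; first by exists (ract x r) => //; rewrite /= fR.
suff: range (pow_map f (n := n.+1)) `<=`
    (fun b => b * sigma r) @^-1` range (pow_map f (n := n.+1)).
  by apply; exists x.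
apply: pow_map_sub => [|y q].
  apply: subgroup_preimage (numulBl _) (subgroup_range _).
  exact: (pow_mapB fB fR fL (n := n.+1)).
by rewrite /preimage/= -mulgA -fR; apply: pow_map_mul.
Qed.

End Powers.

Section Bicyclic.
Local Open Scope group_scope.
Implicit Types s t : bicyclic.

Lemma bicyclic_mulE s t : s * t = bicyclic_mul s t.
Proof. by []. Qed.

Lemma bicyclic_mul1 s : bicyclic_mul (0, 0)%N s = s.
Proof. by case: s => [[|k] l] /=; rewrite ?add0n ?subn0. Qed.

End Bicyclic.

(** * The components of a covariant representation: spanning and minimality *)

Section ToeplitzComponents.
Local Open Scope ring_scope.
Local Open Scope group_scope.
Variables (R : nuRingType) (P Q : bimodType R) (psi : tensor P Q -> R).
Variable X : covrep psi.

Local Notation C := (toeplitz_component X).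
Local Notation S := (cr_S X).
Local Notation T := (cr_T X).
Local Notation sigma := (cr_sigma X).

Let SB n :=
  pow_mapB (cr_S_additive X) (@cr_SR _ _ _ _ X) (@cr_SL _ _ _ _ X) (n := n).
Let TB n :=
  pow_mapB (cr_T_additive X) (@cr_TR _ _ _ _ X) (@cr_TL _ _ _ _ X) (n := n).
Let S_sub := pow_map_sub (cr_S_additive X) (@cr_SR _ _ _ _ X) (@cr_SL _ _ _ _ X).
Let T_sub := pow_map_sub (cr_T_additive X) (@cr_TR _ _ _ _ X) (@cr_TL _ _ _ _ X).
Let S_mul := pow_map_mul (cr_S_additive X) (@cr_SR _ _ _ _ X) (@cr_SL _ _ _ _ X).
Let T_mul := pow_map_mul (cr_T_additive X) (@cr_TR _ _ _ _ X) (@cr_TL _ _ _ _ X).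
Let S_scale := pow_map_scale (cr_S_additive X) (@cr_SR _ _ _ _ X) (@cr_SL _ _ _ _ X).
Let T_scale := pow_map_scale (cr_T_additive X) (@cr_TR _ _ _ _ X) (@cr_TL _ _ _ _ X).

Lemma subgroup_component s : subgroup_set (C s).
Proof.
case: s => [[|m] [|n]] /=.
- by apply: subgroup_range; case: (cr_sigma_hom X).
- exact: subgroup_range (@SB n).
- exact: subgroup_range (@TB m).
- exact: subgroup_additive_span.
Qed.

Lemma component_TS m n a b : range (pow_map T (n := m)) a ->
  range (pow_map S (n := n)) b -> C (m.+1, n.+1) (a * b).
Proof. by move=> [q _ <-] [p _ <-]; apply: sub_additive_span; exists q, p. Qed.

(** Right multiplication by c is reduced to the spanning products, bracketed so that c meets the
    power of P. *)
Lemma component_mulr_sub m n (c : X) (W : set X) : subgroup_set W ->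
  (forall x y, W (pow_map T (n := m) x * (pow_map S (n := n) y * c))) ->
  forall x, C (m.+1, n.+1) x -> W (x * c).
Proof.
move=> Wgrp WM; apply: (additive_span_min (Y := (fun x => x * c) @^-1` W)).
  exact: subgroup_preimage (numulBl _) Wgrp.
by move=> _ [x [y ->]]; rewrite /preimage/= -mulgA.
Qed.

Lemma component_sigma s x r : C s x -> C s (x * sigma r).
Proof.
case: s => [[|m] [|n]].
- move=> [u _ <-]; exists (u * r) => //.
  by case: (cr_sigma_hom X) => _ ->.
- by move=> [p _ <-]; apply: S_scale.
- by move=> [q _ <-]; apply: T_scale.
- apply: component_mulr_sub (subgroup_component (m.+1, n.+1)) _ x => q p.
  by apply: component_TS; [exists q|apply: S_scale].
Qed.

Lemma component_S m n x p : C (m, n) x -> C (m, n.+1) (x * S p).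
Proof.
case: m n => [|m] [|n].
- by move=> [r _ <-]; exists (lact r p) => //; rewrite /= cr_SL.
- by move=> [y _ <-]; apply: S_mul.
- by move=> [q _ <-]; apply: component_TS; [exists q|exists p].
- apply: component_mulr_sub (subgroup_component (m.+1, n.+2)) _ x => q y.
  by apply: component_TS; [exists q|apply: S_mul].
Qed.

(** The last factor p of the power meets q and collapses to psi(p, q) in R, which the remaining n+1
    factors absorb. *)
Lemma pow_map_S_T n (x : tensor_pow P n.+1) q :
  range (pow_map S (n := n)) (pow_map S (n := n.+1) x * T q).
Proof.
suff: range (pow_map S (n := n.+1)) `<=`
    (fun b => b * T q) @^-1` range (pow_map S (n := n)).
  by apply; exists x.
apply: S_sub => [|y p].
  exact: subgroup_preimage (numulBl _) (subgroup_range (@SB n)).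
by rewrite /preimage/= -mulgA -cr_psi; apply: S_scale.
Qed.

(** Multiplication by T splits into two lemmas because (m,0)(1,0) = (m+1,0), whereas (m,n+1)(1,0) =
    (m,n). *)
Lemma component_T0 m x q : C (m, 0) x -> C (m.+1, 0) (x * T q).
Proof.
case: m => [|m].
  by move=> [r _ <-]; exists (lact r q) => //; rewrite /= cr_TL.
by move=> [y _ <-]; apply: T_mul.
Qed.

Lemma component_T m n x q : C (m, n.+1) x -> C (m, n) (x * T q).
Proof.
case: m n => [|m] [|n].
- by move=> [p _ <-]; exists (psi (tens p q)) => //; rewrite /= cr_psi.
- by move=> [y _ <-]; apply: pow_map_S_T.
- apply: component_mulr_sub (subgroup_component (m.+1, 0)) _ x => y p.
  by rewrite /= -cr_psi; apply: T_scale.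
- apply: component_mulr_sub (subgroup_component (m.+1, n.+1)) _ x => y p.
  by apply: component_TS; [exists y|apply: pow_map_S_T].
Qed.

Let U : set X := additive_span (\bigcup_(s in [set: bicyclic]) C s).

Let UC s : C s `<=` U.
Proof. by move=> x Cx; apply: sub_additive_span; exists s. Qed.

Let U_mulr (c : X) : (forall s x, C s x -> U (x * c)) ->
  forall x, U x -> U (x * c).
Proof.
move=> CU; apply: additive_span_min => [|x [s _ Cx]]; last exact: CU Cx.
exact: subgroup_preimage (numulBl c) (subgroup_additive_span _).
Qed.

Lemma component_span : cr_surjective X ->
  forall x, additive_span (\bigcup_(s in [set: bicyclic]) C s) x.
Proof.
(* Adding the stability of U under right multiplication by x turns the condition into one that
   defines a subring, to be checked on generators. *)
move=> Xsurj x; suff: U x /\ forall u, U u -> U (u * x) by case.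
have [U0 UB] : subgroup_set U by apply: subgroup_additive_span.
apply: (@cr_surjective_ind _ _ _ _ X [set x | U x /\ forall u, U u -> U (u * x)])
  => //= [|r|q|p].
- split; first split=> [|y z [Uy hy] [Uz hz]].
  + by split=> // u _; rewrite (zmod_morph0 (numulBr u)).
  + split; first exact: UB.
    by move=> u Uu; rewrite (numulBr u); apply: UB; [apply: hy|apply: hz].
  + move=> y z [Uy hy] [Uz hz]; split; first exact: hz.
    by move=> u Uu; rewrite mulgA; exact: hz _ (hy _ Uu).
- split; first by apply: (UC (s := (0, 0)%N)); exists r.
  by apply: U_mulr => s y /(component_sigma r)/UC.
- split; first by apply: (UC (s := (1, 0)%N)); exists q.
  by apply: U_mulr => -[m [|n]] y => [/(component_T0 q)/UC|/(component_T q)/UC].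
- split; first by apply: (UC (s := (0, 1)%N)); exists p.
  by apply: U_mulr => -[m n] y /(component_S p)/UC.
Qed.

(** Powers of (1,0) and (0,1) are (m,0) and (0,n), and (m,0)(0,n) = (m,n). The lemma serves twice:
    for the elements homogeneous under the coaction and for a competing grading. *)
Lemma component_min (F : bicyclic -> set X) :
  (forall s, subgroup_set (F s)) ->
  (forall s t x y, F s x -> F t y -> F (s * t) (x * y)) ->
  range sigma `<=` F (0, 0)%N -> range T `<=` F (1, 0)%N ->
  range S `<=` F (0, 1)%N -> forall s, C s `<=` F s.
Proof.
move=> Fgrp FM Fsigma FT FS.
have FTn m : range (pow_map T (n := m)) `<=` F (m.+1, 0)%N.
  elim: m => // m IHm; apply: T_sub => // x q.
  have := FM _ _ _ _ (IHm _ (imageT _ x)) (FT _ (imageT _ q)).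
  by rewrite bicyclic_mulE /= subn0 addn1.
have FSn n : range (pow_map S (n := n)) `<=` F (0, n.+1)%N.
  elim: n => // n IHn; apply: S_sub => // x p.
  have := FM _ _ _ _ (IHn _ (imageT _ x)) (FS _ (imageT _ p)).
  by rewrite bicyclic_mulE /= subn0 addn1.
case=> [[|m] [|n]] //; first exact: FSn; first exact: FTn.
apply: additive_span_min => // _ [q [p ->]].
exact: FM (FTn m _ (imageT _ q)) (FSn n _ (imageT _ p)).
Qed.

End ToeplitzComponents.

(** * The coaction of the bicyclic semigroup and the grading *)

Section ToeplitzGrading.
Local Open Scope ring_scope.
Local Open Scope group_scope.
Variables (R : nuRingType) (P Q : bimodType R) (psi : tensor P Q -> R).
Variable X : covrep psi.
Implicit Types (a b x : X) (s t : bicyclic).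

(** The values lie in the unitization, on which X acts faithfully from the left. *)
Local Notation coeffs := (bicyclic -> unitization X).

Definition shift_fun s a (f : coeffs) : coeffs := fun u => lact a (f (u * s)).

Lemma shift_funB s a : zmod_morphism (shift_fun s a).
Proof. by move=> f g; apply: funext => u; apply: lactB. Qed.

(* The semigroup ring X[S] acts on functions by right translation of the argument;
   [shift s a] is the action of a delta_s. *)
Definition shift s a : endo coeffs := endo_of (shift_funB s a).

Lemma shiftE s a f u : shift s a f u = lact a (f (u * s)).
Proof. by []. Qed.

Lemma shiftB s : zmod_morphism (shift s).
Proof.
move=> a b; apply: endoP => f; apply: funext => u.
exact: (lactBl (f (u * s))).
Qed.

(** Translating the argument on the right makes shifts compose in the order of the semigroup, by (u
    s) t = u (s t). *)
Lemma shiftM s t a b : shift s a * shift t b = shift (s * t) (a * b).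
Proof.
apply: endoP => f; apply: funext => u.
by rewrite endo_mulE !shiftE mulgA lactA.
Qed.

Let d0 : bicyclic := (0, 0)%N.
Let dT : bicyclic := (1, 0)%N.
Let dS : bicyclic := (0, 1)%N.

Let sigma' r := shift d0 (cr_sigma X r).
Let T' q := shift dT (cr_T X q).
Let S' p := shift dS (cr_S X p).

Let S'B : zmod_morphism S'.
Proof. by move=> p p'; rewrite /S' (cr_S_additive X) shiftB. Qed.
Let T'B : zmod_morphism T'.
Proof. by move=> q q'; rewrite /T' (cr_T_additive X) shiftB. Qed.
Let sigma'_hom : nuring_hom sigma'.
Proof.
have [sB sM] := cr_sigma_hom X.
by split=> r r'; rewrite /sigma' ?sB ?shiftB // sM shiftM.
Qed.
(** Each relation is inherited from X, and the degrees of its two sides agree by computation; for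
    [psi'] this is (0,1)(1,0) = (0,0). *)
Let S'R p r : S' (ract p r) = S' p * sigma' r.
Proof. by rewrite /S' cr_SR shiftM. Qed.
Let S'L r p : S' (lact r p) = sigma' r * S' p.
Proof. by rewrite /S' cr_SL shiftM. Qed.
Let T'R q r : T' (ract q r) = T' q * sigma' r.
Proof. by rewrite /T' cr_TR shiftM. Qed.
Let T'L r q : T' (lact r q) = sigma' r * T' q.
Proof. by rewrite /T' cr_TL shiftM. Qed.
Let psi' p q : sigma' (psi (tens p q)) = S' p * T' q.
Proof. by rewrite /sigma' cr_psi shiftM. Qed.

Definition shift_covrep : covrep psi :=
  CovRep S'B T'B sigma'_hom S'R S'L T'R T'L psi'.

Section Coaction.
Variable eta : X -> shift_covrep.
Hypothesis eta_hom : cr_hom eta.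

Let etaB : zmod_morphism eta. Proof. by case: eta_hom => [[]]. Qed.
Let etaM : {morph eta : x y / x * y}. Proof. by case: eta_hom => [[]]. Qed.

(** Homogeneity under the coaction is multiplicative because [eta] and [shift] are, without the case
    analysis that products of components would require. *)
Definition homogeneous s : set X := [set x | eta x = shift s x].

Lemma subgroup_homogeneous s : subgroup_set (homogeneous s).
Proof.
split=> [|x y hx hy]; rewrite /homogeneous /=.
  by rewrite (zmod_morph0 etaB) (zmod_morph0 (shiftB s)).
by rewrite etaB hx hy shiftB.
Qed.

Lemma homogeneousM s t x y :
  homogeneous s x -> homogeneous t y -> homogeneous (s * t) (x * y).
Proof. by rewrite /homogeneous /= => hx hy; rewrite etaM hx hy shiftM. Qed.

Lemma component_homogeneous s : toeplitz_component X s `<=` homogeneous s.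
Proof.
apply: component_min => [t|t u x y|x|x|x].
- exact: subgroup_homogeneous.
- exact: homogeneousM.
- by move=> [r _ <-]; exact: cr_hom_sigma.
- by move=> [q _ <-]; exact: cr_hom_T.
- by move=> [p _ <-]; exact: cr_hom_S.
Qed.

Let delta t : coeffs := fun s => if s == t then unitization1 X else 0.

(** This is the coefficient of the coaction at t: x delta_s applied to the function [delta t] and
    evaluated at (0,0) gives x acting on [delta t s], that is (0, x) if s = t and 0 otherwise. *)
Definition degree_part t x : X := ((eta x : endo coeffs) (delta t) d0).2.

Lemma degree_partB t : zmod_morphism (degree_part t).
Proof. by move=> x y; rewrite /degree_part etaB. Qed.

Lemma degree_part_homogeneous s t x :
  homogeneous s x -> degree_part t x = if t == s then x else 0.
Proof.
rewrite /degree_part => ->; rewrite shiftE bicyclic_mulE bicyclic_mul1.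
rewrite /delta; case: (eqVneq s t) => _; first by rewrite lact_unitization1.
by rewrite (zmod_morph0 (@lactB _ _ x)).
Qed.

Lemma component_grading :
  cr_surjective X -> is_grading (toeplitz_component X).
Proof.
move=> Xsurj; have prC s t x (Cx : toeplitz_component X t x) :=
  degree_part_homogeneous s (component_homogeneous Cx).
have Cgrp := @subgroup_component _ _ _ _ X.
have Cspan := component_span Xsurj.
split; first exact: projections_decomposition Cgrp degree_partB prC Cspan.
move=> s t x y Cx Cy.
(* The product is homogeneous of degree s t, so the projection to that degree fixes it, and fixed
   elements lie in the component. *)
apply: (projections_mem Cgrp degree_partB prC Cspan).
rewrite (degree_part_homogeneous (s := s * t)) ?eqxx //.
by apply: homogeneousM; apply: component_homogeneous.
Qed.

End Coaction.

Lemma universal_component_grading : cr_surjective X -> property_TP X ->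
  is_grading (toeplitz_component X).
Proof.
move=> Xsurj /(_ shift_covrep)[eta [eta_hom _]].
exact: component_grading eta_hom Xsurj.
Qed.

End ToeplitzGrading.

Theorem theorem1p7 (R : nuRingType) (P Q : bimodType R)
    (psi : tensor P Q -> R)
    (psi_hom : bimod_hom (psi : tensor P Q -> regular_bimod R)) :
  exists X : covrep psi,
    [/\ cr_injective X /\ cr_surjective X,
        property_TP X,
        forall Y : covrep psi,
          cr_surjective Y -> property_TP Y -> cr_isomorphic Y X,
        forall (Y : covrep psi) (phi : Y -> X),
          cr_surjective Y -> cr_hom phi -> nuring_iso phi
      & is_grading (toeplitz_component X) /\
        forall F : bicyclic -> set X,
          is_grading F ->
          range (cr_sigma X) `<=` F (0, 0) ->
          range (cr_T X) `<=` F (1, 0) ->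
          range (cr_S X) `<=` F (0, 1) ->
          F = toeplitz_component X].
Proof.
exists (toeplitz_covrep psi).
have Xsurj := @toeplitz_surjective R P Q psi.
have XTP := @toeplitz_TP R P Q psi.
have Cgr := universal_component_grading Xsurj XTP.
split=> //.
- by split=> //; apply: toeplitz_injective (@fock_covrep_injective _ _ _ _ psi_hom).
- by move=> Y Ysurj YTP; apply: universal_cr_isomorphic.
- by move=> Y phi Ysurj hphi; apply: hom_to_universal_iso hphi.
- split=> // F [Fdec FM] Fsigma FT FS; symmetry.
  (* Since both families are direct sum decompositions, the inclusion of the components in F is
     enough for equality. *)
  apply: (direct_sum_sub_eq Cgr.1 Fdec).
  exact: component_min Fdec.1 FM Fsigma FT FS.
Qed.
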